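(* Suppose $(X,\mathcal{A},\mu)$ is a complete measure space with $\mu(X)<\infty$. Then a function $f : X \rightarrow \mathbb{R}$ is $T_1$-measurable if and only if it is measurable in the conventional sense.
   Context: For a finite measure space $(X,\mathcal{A},\mu)$ (regarded as a bounded finitely additive charge space): the outer charge is $\mu^*(A):=\inf\{\mu(B): B\in\mathcal{A}, A\subseteq B\}$ for $A\subseteq X$. A sequence $f_n:X\to\mathbb{R}$ converges hazily to $f:X\to\mathbb{R}$ if for every $\epsilon>0$, $\mu^*(\{x:|f_n(x)-f(x)|>\epsilon\})\to 0$ as $n\to\infty$. A simple function is $\sum_{k=1}^K c_kI_{A_k}$ with $c_k\in\mathbb{R}$ and $\{A_1,\dots,A_K\}\subset\mathcal{A}$ a finite partition of $X$. $f$ is $T_1$-measurable if some sequence of simple functions converges hazily to $f$. Conventional measurability is measurability from $\mathcal{A}$ to the Borel sets of $\mathbb{R}$. *)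

(* Defs.v *)
From HB Require Import structures.
From mathcomp Require Export all_boot all_order all_algebra.
From mathcomp Require Export all_classical all_reals all_analysis.

Set Implicit Arguments.
Unset Strict Implicit.
Unset Printing Implicit Defensive.
Import Order.TTheory GRing.Theory Num.Theory.
Import numFieldNormedType.Exports.

Local Open Scope classical_set_scope.
Local Open Scope ring_scope.
Local Open Scope ereal_scope.

(* The infimum runs over single measurable supersets, not over countable covers
   as in [mu_ext]: this is the outer charge of a finitely additive [mu]. *)
Definition outer_charge (d : measure_display) (T : algebraOfSetsType d)
    (R : realType) (mu : set T -> \bar R) (A : set T) : \bar R :=
  ereal_inf [set mu B | B in [set B | measurable B /\ A `<=` B]].

Definition hazily_converges (d : measure_display) (T : algebraOfSetsType d)
    (R : realType) (mu : set T -> \bar R) (f_ : nat -> T -> R) (f : T -> R) :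
    Prop :=
  forall e : R, (0 < e)%R ->
    outer_charge mu [set x | (e < `|f_ n x - f x|)%R] @[n --> \oo] --> 0.

(* Unlike [{sfun T >-> R}], this does not refer to the Borel sets of [R]. *)
Definition simple_function (d : measure_display) (T : algebraOfSetsType d)
    (R : realType) (f : T -> R) : Prop :=
  exists (K : nat) (c : 'I_K -> R) (A : 'I_K -> set T),
    [/\ forall k, measurable (A k),
        partition [set: 'I_K] A [set: T] &
        forall x, f x = (\sum_(k < K) c k * \1_(A k) x)%R].

Definition T1_measurable (d : measure_display) (T : algebraOfSetsType d)
    (R : realType) (mu : set T -> \bar R) (f : T -> R) : Prop :=
  exists f_ : nat -> T -> R,
    (forall n, simple_function (f_ n)) /\ hazily_converges mu f_ f.

(* Main.v *)
(** If [f_n] converges hazily to [f], choose [n_k] and measurable [B_k] with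
    [{|f_(n_k) - f| > 2^-(k+1)} `<=` B_k] and [mu B_k < 2^-(k+1)]. By
    Borel-Cantelli the limsup of the [B_k] is a null set off which [f_(n_k)]
    converges to [f] pointwise, so [f] is measurable because [mu] is complete.
    Conversely, pointwise convergence of simple functions to [f] makes the tail
    unions of [{|f_k - f| > e}] decrease to the empty set, and continuity from
    above of the finite measure [mu] gives hazy convergence. *)

Require Import Defs.
From mathcomp Require Import finmap measurable_realfun.

Set Implicit Arguments.
Unset Strict Implicit.
Unset Printing Implicit Defensive.

Import Order.TTheory GRing.Theory Num.Theory.
Import numFieldNormedType.Exports.
Import HBSimple.

Local Open Scope classical_set_scope.
Local Open Scope ring_scope.
Local Open Scope ereal_scope.

Lemma simple_function_measurable (d : measure_display) (X : measurableType d)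
    (R : realType) (f : X -> R) :
  simple_function f -> measurable_fun [set: X] f.
Proof.
move=> [K [c [A [mA _ fE]]]].
have -> : f = (fun x => \sum_(k < K) c k * \1_(A k) x)%R by exact/funext.
apply: measurable_sum => k; exact: measurable_funM.
Qed.

(** The cells are the fibres over an enumeration [s] of the finite range. [partition] demands
    nonempty cells, so [s] lists only attained values; it has no repetition, which makes the fibres
    disjoint. *)
Lemma sfun_simple_function (d : measure_display) (X : measurableType d)
    (R : realType) (f : {sfun X >-> R}) : simple_function f.
Proof.
pose s := fset_set (range f).
have range_f y : (y \in s) = (y \in range f).
  by rewrite in_fset_set//; exact: fimfunP.
exists #|` s|, (fun i => s`_i)%R, (fun i => f @^-1` [set s`_i])%R; split.
- by move=> k; exact: measurable_funPTI.
- split.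
  + apply/seteqP; split=> // x _; have : f x \in s by rewrite range_f; exact: mem_set.
    by move=> /(nthP 0%R)[i ilt fxE]; exists (Ordinal ilt).
  + move=> i j _ _ [x [/= -> /eqP]].
    by rewrite (nth_uniq _ _ _ (fset_uniq _))// => /eqP/val_inj.
  + move=> i _; have : (s`_i)%R \in s by exact: mem_nth.
    by rewrite range_f => /set_mem[x _ fxE]; exists x.
- by move=> x; rewrite [LHS]fimfunEord.
Qed.

Lemma outer_charge_ge0 (d : measure_display) (X : algebraOfSetsType d)
    (R : realType) (mu : {content set X -> \bar R}) (A : set X) :
  0 <= outer_charge mu A.
Proof. by apply: le_ereal_inf_tmp => _ [B _ <-]; exact: measure_ge0. Qed.

Lemma outer_charge_le (d : measure_display) (X : algebraOfSetsType d)
    (R : realType) (mu : set X -> \bar R) (A B : set X) :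
  measurable B -> A `<=` B -> outer_charge mu A <= mu B.
Proof. by move=> mB AB; apply: ereal_inf_lbound; exists B. Qed.

Lemma pointwise_cvg_hazily (d : measure_display) (X : measurableType d)
    (R : realType) (mu : {measure set X -> \bar R}) (f_ : (X -> R)^nat)
    (f : X -> R) :
  mu [set: X] < +oo -> (forall n, measurable_fun [set: X] (f_ n)) ->
  (forall x, f_ ^~ x @ \oo --> f x) -> hazily_converges mu f_ f.
Proof.
move=> mu_fin mf_ f_f e e0.
have mf : measurable_fun [set: X] f.
  by apply: (measurable_fun_cvg mf_) => x _; exact: f_f.
pose F k := [set x | (e < `|f_ k x - f x|)%R].
have mF k : measurable (F k).
  have -> : F k = [set: X] `&` (fun x => `|f_ k x - f x|)%R @^-1` `]e, +oo[.
    by apply/seteqP; split=> x; rewrite /F /= in_itv/= andbT// => -[].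
  have : measurable_fun [set: X] (fun x => `|f_ k x - f x|)%R.
    by apply: measurableT_comp => //; exact: measurable_funB.
  by apply.
have mtail n : measurable (\bigcup_(k >= n) F k).
  by apply: bigcup_measurable => k _; exact: mF.
have limF : lim_sup_set F = set0.
  apply/seteqP; split=> // x Fx; have := f_f x.
  move=> /cvgrPdist_le /(_ e e0) [n _ nP].
  have [k /= nk] := Fx n I.
  by rewrite /F /= distrC ltNge nP.
have tail0 : mu (\bigcup_(k >= n) F k) @[n --> \oo] --> 0.
  rewrite -(measure0 mu) -limF; apply: lim_sup_set_cvg => //.
  (* Continuity from above needs the first tail union to have finite measure. *)
  by rewrite (le_lt_trans _ mu_fin)// le_measure// in_setE.
apply: (squeeze_cvge _ (cvg_cst 0) tail0); apply: nearW => n.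
rewrite outer_charge_ge0/= outer_charge_le// => x Fx.
by exists n => /=.
Qed.

Lemma hazily_cvg_measurable (d : measure_display) (X : measurableType d)
    (R : realType) (mu : {measure set X -> \bar R}) (f_ : (X -> R)^nat)
    (f : X -> R) :
  measure_is_complete mu -> (forall n, measurable_fun [set: X] (f_ n)) ->
  hazily_converges mu f_ f -> measurable_fun [set: X] f.
Proof.
move=> mu_complete mf_ f_f.
(* [r k] serves both as tolerance and as bound on [mu (B k)]. Its shape is that of the summand in
   [epsilon_trick0] with total 1, so the measures of the [B k] sum to at most 1. *)
pose r k : R := (1 / (2 ^ k.+1)%:R)%R.
have r0 k : (0 < r k)%R by rewrite divr_gt0// ltr0n expn_gt0.
have /choice[nB nBP] k : exists nB : nat * set X,
    [/\ measurable nB.2, [set x | r k < `|f_ nB.1 x - f x|]%R `<=` nB.2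
      & mu nB.2 < (r k)%:E].
  have nbhs_r : nbhs (0 : \bar R) [set y | y < (r k)%:E].
    apply: open_nbhs_nbhs; split; first exact: open_ereal_lt_ereal.
    by rewrite /= lte_fin.
  have [n _ /(_ n (leqnn n)) /= /ereal_inf_lt[_ [B [mB AB] <-] muB]] :=
    f_f (r k) (r0 k) _ nbhs_r.
  by exists (n, B).
pose n_ k := (nB k).1; pose B k := (nB k).2; pose N := lim_sup_set B.
have mB k : measurable (B k) by have [] := nBP k.
have mN : measurable N.
  by apply: bigcapT_measurable => n; apply: bigcup_measurable => k _; exact: mB.
have N0 : mu N = 0.
  apply: lim_sup_set_cvg0 => //; apply: (@le_lt_trans _ _ 1); last exact: ltry.
  apply: le_trans (epsilon_trick0 xpredT (@ler01 R)).
  by apply: lee_nneseries => // k _; have [_ _ /ltW] := nBP k.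
(* Killing the values on [N] turns convergence off [N] into convergence at every point, so [g] is
   measurable as a pointwise limit. *)
pose g x := (f x * \1_(~` N) x)%R.
have mg : measurable_fun [set: X] g.
  apply: (@measurable_fun_cvg _ _ _ _
    (fun k x => f_ (n_ k) x * \1_(~` N) x)%R) => [k|x _].
    by apply: measurable_funM => //; apply: measurable_indic; exact: measurableC.
  rewrite /g indicE; case: (boolP (x \in ~` N)) => [|_]; last first.
    by rewrite mulr0; under eq_fun do rewrite mulr0; exact: cvg_cst.
  move=> /set_mem Nx; rewrite mulr1; under eq_fun do rewrite mulr1.
  (* A point outside the limsup lies in only finitely many [B k]. From then on the error is at most
     [r k], whether or not the indices [n_ k] increase. *)
  have [n nBx] : exists n, forall k, (n <= k)%N -> ~ B k x.
    apply: contrapT => /forallNP tailB; apply: Nx => n _.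
    have /existsNP[k /not_implyP[nk /contrapT Bx]] := tailB n.
    by exists k.
  apply/cvgrPdist_lt => _/posnumP[e].
  have [m _ mP] := near_infty_natSinv_expn_lt e.
  exists (maxn n m) => // k /=; rewrite geq_max => /andP[nk mk].
  (* The exponent in [r k] is [k.+1], hence this instance of [mP]. *)
  apply: le_lt_trans (mP k.+1 (leqW mk)); rewrite -natrX distrC leNgt.
  have [_ AB _] := nBP k.
  by apply/negP => /AB; exact: nBx.
(* Completeness enters here: [f] agrees with the measurable [g] off the null set [N]. *)
apply/measurable_EFinP; apply: (ae_measurable_fun mu_complete (f := EFin \o g)).
  exists N; split=> // x /= /not_implyP[_ gNf]; apply: contrapT => Nx.
  by apply: gNf; rewrite /g indicE mem_set// mulr1.
exact/measurable_EFinP.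
Qed.

Theorem corollary21 (d : measure_display) (X : measurableType d) (R : realType)
    (mu : {measure set X -> \bar R})
    (mu_complete : measure_is_complete mu) (mu_fin : mu [set: X] < +oo)
    (f : X -> R) :
  T1_measurable mu f <-> measurable_fun [set: X] f.
Proof.
split=> [[f_ [sf_ f_f]]|/measurable_EFinP mf].
  apply: hazily_cvg_measurable f_f => // n.
  exact: simple_function_measurable.
have [g gf] := approximation_sfun measurableT mf.
exists g; split=> [n|]; first exact: sfun_simple_function.
apply: pointwise_cvg_hazily => // x.
exact: (fine_cvg (gf x I)).
Qed.
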